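(* Let $d\ge 1$ and let $P\subset\mathbb{R}^d$ be a convex polytope with vertices in $\mathbb{Z}^d$. Suppose that $P$ multi-tiles $\mathbb{R}^d$ under the group $\mathcal{G}$, i.e. there is an integer $m$ such that $\sum_{g\in\mathcal{G}}1_P(gx)=m$ for almost every $x\in\mathbb{R}^d$. Then for every positive integer $n$, \[G_P(n)=\operatorname{vol}(P)\,G(n)^d .\]
   Context: $\mathcal{W}$ denotes the finite group of linear maps of $\mathbb{R}^d$ generated by the reflections in the coordinate hyperplanes and all permutations of the coordinates (so $|\mathcal{W}|=2^d d!$), and $\mathcal{G}$ is the group of maps of $\mathbb{R}^d$ generated by $\mathcal{W}$ and all translations by vectors of $\mathbb{Z}^d$. $1_P$ is the indicator function of $P$. For $x\in\mathbb{R}^d$, the solid angle $\omega_P(x)$ is $\operatorname{vol}(B(x,r)\cap P)/\operatorname{vol}(B(x,r))$ for all sufficiently small $r>0$ (so it is $1$ in the interior of $P$, $0$ outside $P$). Write $e(t)=e^{2\pi i t}$. The polyhedral Gauss sum is $G_P(n)=\sum_{x\in\mathbb{Z}^d}\omega_{nP}(x)\,e(\|x\|^2/n)$, where $nP$ is the dilate of $P$ by $n$, and $G(n)=\sum_{k\in\mathbb{Z}/n\mathbb{Z}}e(k^2/n)$ is the classical Gauss sum. *)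

(* Defs.v *)
From HB Require Import structures.
From mathcomp Require Import all_boot all_order all_algebra all_fingroup.
From mathcomp Require Import all_classical all_reals all_analysis.
From mathcomp Require Import complex.

Set Implicit Arguments.
Unset Strict Implicit.
Unset Printing Implicit Defensive.

Import Order.TTheory GRing.Theory Num.Theory.
Local Open Scope ring_scope.
Local Open Scope classical_set_scope.

Section Defs.
Variables (R : realType) (d : nat).

Definition vec := 'rV[R]_d.

Definition zvec (t : 'rV[int]_d) : vec := map_mx (fun z : int => z%:~R) t.

Definition sqnorm (x : vec) : R := \sum_(i < d) (x 0 i) ^+ 2.

Definition eball (x : vec) (r : R) : set vec := [set y | sqnorm (y - x) < r ^+ 2].

Definition box (a b : vec) : set vec := [set y | forall i, a 0 i <= y 0 i <= b 0 i].
Definition boxvol (a b : vec) : R := \prod_(i < d) Num.max (b 0 i - a 0 i) 0.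

Definition lebesgue_outer (A : set vec) : \bar R :=
  ereal_inf [set s | exists a b : nat -> vec,
     A `<=` \bigcup_k box (a k) (b k) /\
     s = (\sum_(0 <= k <oo) (boxvol (a k) (b k))%:E)%E].

(* Real-valued volume (used for bounded sets). *)
Definition vol (A : set vec) : R := fine (lebesgue_outer A).

Definition ae (Q : vec -> Prop) : Prop :=
  exists N : set vec, lebesgue_outer N = 0%E /\ forall x, ~ N x -> Q x.

Definition lattice_hull (V : seq 'rV[int]_d) : set vec :=
  [set x | exists lam : 'I_(size V) -> R,
     (forall i, 0 <= lam i) /\ \sum_(i < size V) lam i = 1 /\
     x = \sum_(i < size V) lam i *: zvec (tnth (in_tuple V) i)].

Definition dilate (n : R) (P : set vec) : set vec := [set n *: y | y in P].

Definition solid_angle (P : set vec) (x : vec) : R :=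
  xget 0 [set w : R | exists r0 : R, 0 < r0 /\ forall r : R, 0 < r -> r < r0 ->
     vol (eball x r `&` P) / vol (eball x r) = w].

(* The group W of signed permutations: w = (s, sigma) acts by
   (w x)_i = (-1)^(s i) * x_(sigma i).  G = { x |-> w x + t : w in W, t in Z^d }. *)
Definition Wact (s : {ffun 'I_d -> bool}) (sigma : {perm 'I_d}) (x : vec) : vec :=
  \row_i ((-1) ^+ s i * x 0 (sigma i)).

Definition Gelt := ({ffun 'I_d -> bool} * {perm 'I_d} * 'rV[int]_d)%type.

Definition Gact (g : Gelt) (x : vec) : vec := Wact g.1.1 g.1.2 x + zvec g.2.

Definition multitiles (P : set vec) : Prop :=
  exists m : int, ae (fun x =>
    (\esum_(g in [set: Gelt]) ((\1_P (Gact g x) : R)%:E) : \bar R)%E = (m%:~R)%:E).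

End Defs.

Section Gauss.
Variable R : realType.
Local Open Scope complex_scope.

Definition expi (t : R) : R[i] := (cos (2 * pi * t)) +i* (sin (2 * pi * t)).

Definition gauss (n : nat) : R[i] := \sum_(k < n) expi ((k ^ 2)%:R / n%:R).

(* Sum over Z^d of a finitely supported f : the eventual value of the
   partial sums over the cubes [-N, N]^d. *)
Definition cube_sum (d : nat) (f : 'rV[int]_d -> R[i]) (N : nat) : R[i] :=
  \sum_(u : {ffun 'I_d -> 'I_(N.*2.+1)}) f (\row_i ((u i)%:Z - N%:Z)).

Definition lattice_sum (d : nat) (f : 'rV[int]_d -> R[i]) : R[i] :=
  xget 0 [set S | exists N0 : nat, forall N, (N0 <= N)%N -> cube_sum f N = S].

Definition poly_gauss (d : nat) (P : set 'rV[R]_d) (n : nat) : R[i] :=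
  lattice_sum (fun x : 'rV[int]_d =>
    (solid_angle (dilate n%:R P) (zvec R x))%:C * expi (sqnorm (zvec R x) / n%:R)).

End Gauss.

(* Main.v *)
(** The weight [e(|x|^2/n)] of a lattice point [x] is invariant under the signed
    permutations and under translations by [n Z^d].  Averaging the tiling identity
    over small balls turns it into an identity for solid angles that holds at every
    point [y]: the sum over [w] and [t] of [omega_P (w (y + t))] is [m].  For each
    [w], writing the lattice points uniquely as [w (k + n t)] with [k] reduced modulo
    [n] expresses [G_P(n)] as the sum over [k] of [e(|k|^2/n)] times the sum over [t]
    of [omega_P (w (k/n + t))]; summing over [w] gives [|W| G_P(n) = m G(n)^d].
    Integrating the tiling identity over the unit cube gives [m = |W| vol(P)]. *)

Require Import Defs.
From HB Require Import structures.
From mathcomp Require Import all_boot all_order all_algebra all_fingroup.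
From mathcomp Require Import all_classical all_reals all_analysis.
From mathcomp Require Import complex.
From mathcomp Require Import measurable_realfun ring lra zify.

Set Implicit Arguments.
Unset Strict Implicit.
Unset Printing Implicit Defensive.

Import Order.TTheory GRing.Theory Num.Theory.
Import numFieldNormedType.Exports.
Local Open Scope ring_scope.
Local Open Scope classical_set_scope.

(** * Row vectors *)

Lemma ler_rV_norm {K : realDomainType} {n} (x : 'rV[K]_n) (M : K) : 0 <= M ->
  `|x| <= M <-> forall i, `|x 0 i| <= M.
Proof.
move=> M0; rewrite [`|x|]mx_normrE; split=> [/bigmax_leP[_ xM] i|xM].
  exact: (xM (0, i)).
by apply/bigmax_leP; split=> // -[j i] _; rewrite ord1.
Qed.

Lemma ler_norm_coord {K : realDomainType} {n} (x : 'rV[K]_n) i : `|x 0 i| <= `|x|.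
Proof. by move: i; apply/ler_rV_norm. Qed.

Lemma ltr_rV_norm {K : realDomainType} {n} (x : 'rV[K]_n) (M : K) : 0 < M ->
  `|x| < M <-> forall i, `|x 0 i| < M.
Proof.
move=> M0; rewrite [`|x|]mx_normrE; split=> [/bigmax_ltP[_ xM] i|xM].
  exact: (xM (0, i)).
by apply/bigmax_ltP; split=> // -[j i] _; rewrite ord1.
Qed.

Definition floor_rV {R : realType} {n} (x : 'rV[R]_n) : 'rV[int]_n := map_mx Num.floor x.

Lemma dist_same_floor {R : realType} {n} (l : R) (x y : 'rV[R]_n) : 0 < l ->
  floor_rV (l *: x) = floor_rV (l *: y) -> `|x - y| < l^-1.
Proof.
move=> l0 /rowP xy; apply/ltr_rV_norm; rewrite ?invr_gt0// => i.
have := xy i; rewrite !mxE => xyi.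
have /andP[xl xr] := floor_itv (l * x 0 i).
have /andP[yl yr] := floor_itv (l * y 0 i).
rewrite -(ltr_pM2l l0) divff ?gt_eqF// -{1}(gtr0_norm l0) -normrM mulrBr ltr_norml.
by move: xl xr yl yr; rewrite -xyi intrD => *; apply/andP; split; lra.
Qed.

(** * Lebesgue outer measure *)

Section boxes.
Context {R : realType} {d : nat}.
Implicit Types a b x : vec R d.

Lemma boxvol_ge0 a b : 0 <= boxvol a b.
Proof. by apply: prodr_ge0 => i _; rewrite le_max lexx orbT. Qed.

Lemma boxvol_gt0_lt a b : 0 < boxvol a b -> forall i, a 0 i < b 0 i.
Proof.
move=> ab0 i; rewrite ltNge; apply/negP => ba.
move: ab0; rewrite /boxvol (bigD1 i)//= max_r ?mul0r ?ltxx//.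
by rewrite subr_le0.
Qed.

Lemma le_boxvol a b a' b' : box a b `<=` box a' b' -> boxvol a b <= boxvol a' b'.
Proof.
move=> sub; have [/boxvol_gt0_lt lt_ab|] := ltP 0 (boxvol a b); last first.
  by move=> /le_trans; apply; exact: boxvol_ge0.
have /sub a_in : box a b a by move=> i; rewrite lexx ltW.
have /sub b_in : box a b b by move=> i; rewrite lexx ltW.
apply: ler_prod => i _; rewrite le_max lexx orbT/=.
have /andP[? _] := a_in i; have /andP[_ ?] := b_in i.
by rewrite ge_max !le_max lexx orbT andbT lerB.
Qed.

Definition set_coord (i : 'I_d) (t : R) x : vec R d :=
  \row_j if j == i then t else x 0 j.

Lemma boxvol_cut (i : 'I_d) (t : R) a b :
  boxvol a b = boxvol a (set_coord i (Num.min (b 0 i) t) b) +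
               boxvol (set_coord i (Num.max (a 0 i) t) a) b.
Proof.
pose p := \prod_(j < d | j != i) Num.max (b 0 j - a 0 j) 0.
have volE (u v : vec R d) :
    (forall j, j != i -> u 0 j = a 0 j) -> (forall j, j != i -> v 0 j = b 0 j) ->
    boxvol u v = Num.max (v 0 i - u 0 i) 0 * p.
  move=> ua vb; rewrite /boxvol (bigD1 i)//=; congr (_ * _).
  by apply: eq_bigr => j ji; rewrite ua ?vb.
have coord_neq x s j : j != i -> (set_coord i s x) 0 j = x 0 j.
  by move=> /negPf ji; rewrite mxE ji.
rewrite !volE//; try exact: coord_neq.
rewrite -mulrDl !mxE eqxx; congr (_ * _).
by rewrite !maxEle !minEle; do !case: ifP => /=; lra.
Qed.

Lemma lebesgue_outer_ge0 (A : set (vec R d)) : (0 <= lebesgue_outer A)%E.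
Proof.
apply: le_ereal_inf_tmp => _ [a [b [_ ->]]].
by apply: nneseries_ge0 => k _ _; rewrite lee_fin boxvol_ge0.
Qed.

End boxes.

(* [mu_ext] makes an outer measure out of any set function on a semiring of
   sets: [lebesgue_outer] is the case of the box volume, extended by [+oo] to
   the semiring of all sets. *)
Definition all_sets (R : realType) (d : nat) := vec R d.

HB.instance Definition _ (R : realType) (d : nat) :=
  Pointed.copy (all_sets R d) 'rV[R]_d.
HB.instance Definition _ (R : realType) (d : nat) :=
  @isMeasurable.Build default_measure_display
    (all_sets R d) setT I (fun _ _ => I) (fun _ _ => I).

Definition box_premeasure (R : realType) (d : nat) (A : set (all_sets R d)) : \bar R :=
  ereal_inf [set (boxvol ab.1 ab.2)%:E | ab in [set ab | A = box ab.1 ab.2]].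

Section box_premeasure.
Context {R : realType} {d : nat}.

Lemma box_premeasure_box (a b : vec R d) : box_premeasure (box a b) = (boxvol a b)%:E.
Proof.
apply/le_anti/andP; split; first by apply: ereal_inf_lbound; exists (a, b).
by apply: le_ereal_inf_tmp => _ [[a' b']/= ab <-]; rewrite lee_fin le_boxvol ?ab.
Qed.

Lemma box_premeasure_ge0 (A : set (all_sets R d)) : (0 <= box_premeasure A)%E.
Proof. by apply: le_ereal_inf_tmp => _ [ab _ <-]; rewrite lee_fin boxvol_ge0. Qed.

Lemma box_premeasure_lty (A : set (all_sets R d)) :
  (box_premeasure A < +oo)%E -> exists ab : vec R d * vec R d, A = box ab.1 ab.2.
Proof. by move=> /ereal_inf_lt[_ [ab Aab _] _]; exists ab. Qed.

Lemma mu_ext_box_premeasure : mu_ext (@box_premeasure R d) = @lebesgue_outer R d.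
Proof.
apply/funext => A; apply/le_anti/andP; split; apply: le_ereal_inf_tmp.
  move=> _ [a [b [Aab ->]]]; apply: ereal_inf_lbound.
  exists (fun k => box (a k) (b k)); first by split.
  by apply: eq_eseriesr => k _; exact: box_premeasure_box.
move=> _ [B [_ AB] <-].
have [Bfin|/existsNP[k Bk]] := pselect (forall k, (box_premeasure (B k) < +oo)%E); last first.
  rewrite (@eseries_pinfty _ _ xpredT k) ?leey// => [n _|].
    by rewrite -ltNye (lt_le_trans _ (box_premeasure_ge0 _)).
  by apply/eqP; rewrite -leye_eq leNgt; exact/negP.
have /choice[ab Bab] := fun k => box_premeasure_lty (Bfin k).
apply: ereal_inf_lbound; exists (fun k => (ab k).1), (fun k => (ab k).2); split.
  by move=> x /AB[k _ Bx]; exists k => //; rewrite -Bab.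
by apply: eq_eseriesr => k _; rewrite Bab box_premeasure_box.
Qed.

End box_premeasure.

Section lebesgue_outer_measure.
Context {R : realType} {d : nat}.

Lemma set0_box : set0 = box (const_mx 1) (0 : vec R d.+1).
Proof.
apply/seteqP; split=> // x /(_ ord0); rewrite !mxE => /andP[x1 x0].
by have := le_trans x1 x0; rewrite ler10.
Qed.

Lemma box_premeasure0 : box_premeasure (set0 : set (all_sets R d.+1)) = 0%E.
Proof.
rewrite set0_box box_premeasure_box /boxvol big_ord_recl max_r ?mul0r//.
by rewrite !mxE lerBlDr add0r ler01.
Qed.

Lemma lebesgue_outer0 : lebesgue_outer (set0 : set (vec R d.+1)) = 0%E.
Proof.
rewrite -mu_ext_box_premeasure; apply: mu_ext0; first exact: box_premeasure0.
exact: box_premeasure_ge0.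
Qed.

Lemma le_lebesgue_outer :
  {homo @lebesgue_outer R d.+1 : A B / A `<=` B >-> (A <= B)%E}.
Proof. by rewrite -mu_ext_box_premeasure => A B; exact: (@le_mu_ext _ (all_sets R d.+1)). Qed.

Lemma lebesgue_outer_sigma_subadditive : sigma_subadditive (@lebesgue_outer R d.+1).
Proof.
rewrite -mu_ext_box_premeasure.
by apply: (@mu_ext_sigma_subadditive _ (all_sets R d.+1)); exact: box_premeasure_ge0.
Qed.

HB.instance Definition _ := isOuterMeasure.Build R (vec R d.+1) (@lebesgue_outer R d.+1)
  lebesgue_outer0 lebesgue_outer_ge0 le_lebesgue_outer lebesgue_outer_sigma_subadditive.

Lemma lebesgue_outer_box_le (a b : vec R d.+1) :
  (lebesgue_outer (box a b) <= (boxvol a b)%:E)%E.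
Proof.
rewrite -box_premeasure_box -mu_ext_box_premeasure.
apply: ereal_inf_lbound; exists (fun k => if k is 0 then box a b else set0).
  by split=> // x abx; exists 0.
rewrite nneseries_recl//; last by move=> k _; exact: box_premeasure_ge0.
rewrite eseries_cond eseries0 ?adde0// => -[//|k] _ _.
exact: box_premeasure0.
Qed.

End lebesgue_outer_measure.

(* The dimension is [d.+1], because in dimension 0 even the empty set has outer
   measure [+oo]. *)
Definition lebesgue_space (R : realType) (d : nat) :=
  caratheodory_type (@lebesgue_outer R d.+1).

Definition lebesgue_rV (R : realType) (d : nat) :
    {measure set (lebesgue_space R d) -> \bar R} :=
  (@lebesgue_outer R d.+1 : {outer_measure set (vec R d.+1) -> \bar R})
    : set (lebesgue_space R d) -> \bar R.

Section lebesgue_measurable_sets.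
Context {R : realType} {d : nat}.

Lemma measurable_halfspace (i : 'I_d.+1) (t : R) :
  measurable ([set x : vec R d.+1 | x 0 i < t] : set (lebesgue_space R d)).
Proof.
apply: le_caratheodory_measurable => X; apply: le_ereal_inf_tmp => _ [a [b [Xab ->]]].
pose lo k := set_coord i (Num.max (a k 0 i) t) (a k).
pose hi k := set_coord i (Num.min (b k 0 i) t) (b k).
rewrite (eq_eseriesr (g := fun k =>
  (boxvol (a k) (hi k))%:E + (boxvol (lo k) (b k))%:E)%E); last first.
  by move=> k _; rewrite -EFinD -boxvol_cut.
rewrite nneseriesD; try by move=> k _ _; rewrite lee_fin boxvol_ge0.
apply: leeD; apply: ereal_inf_lbound.
  exists a, hi; split=> // x [/Xab[k _ abx] /= xt]; exists k => // j; rewrite mxE.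
  have /andP[-> xb]/= := abx j.
  by case: eqP xb => // -> xb; rewrite le_min xb ltW.
exists lo, b; split=> // x [/Xab[k _ abx] /negP]; rewrite -leNgt => tx.
exists k => // j; rewrite mxE; have /andP[ax ->] := abx j; rewrite andbT.
by case: eqP ax => // -> ax; rewrite ge_max ax.
Qed.

Definition grid_cell {n} (l : R) (z : 'rV[int]_n) : set (vec R n) :=
  [set x | floor_rV (l *: x) = z].

Lemma measurable_grid_cell (l : R) (z : 'rV[int]_d.+1) : 0 < l ->
  measurable (grid_cell l z : set (lebesgue_space R d)).
Proof.
move=> l0; have -> : grid_cell l z = \bigcap_(i in [set: 'I_d.+1])
    ([set x : vec R d.+1 | x 0 i < (z 0 i + 1)%:~R / l] `\`
     [set x : vec R d.+1 | x 0 i < (z 0 i)%:~R / l]).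
  apply/seteqP; split=> x /=.
    move=> <- i _ /=; rewrite !mxE ltr_pdivlMr// mulrC floorD1_gt; split=> //.
    by apply/negP; rewrite -leNgt ler_pdivrMr// mulrC floor_le.
  move=> xz; apply/rowP => i; have [] := xz i Logic.I => /=.
  rewrite !mxE ltr_pdivlMr// => xi /negP; rewrite -leNgt ler_pdivrMr// => ix.
  by apply: floor_def; rewrite mulrC ix.
apply: fin_bigcap_measurable => // i _.
by apply: measurableD; exact: measurable_halfspace.
Qed.

Lemma measurable_open_rV (U : set 'rV[R]_d.+1) :
  open U -> measurable (U : set (lebesgue_space R d)).
Proof.
move=> oU; have -> : U = \bigcup_(p in [set: nat * 'rV[int]_d.+1])
    (if `[< grid_cell p.1.+1%:R p.2 `<=` U >] then grid_cell p.1.+1%:R p.2 else set0).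
  apply/seteqP; split=> [x Ux|x [p _]]; last by case: asboolP => // sub /sub.
  have /nbhs_ballP[e /= e0 xeU] : nbhs x U by exact: open_nbhs_nbhs.
  pose n := Num.trunc e^-1; exists (n, floor_rV (n.+1%:R *: x)) => //=.
  rewrite asboolT// => y xy; apply: xeU.
  rewrite -ball_normE /=; apply: (lt_trans (dist_same_floor _ (esym xy))) => //.
  by rewrite invf_plt ?posrE// truncnS_gt.
apply: countable_bigcupT_measurable; first exact: countableP.
by move=> p; case: ifP => // _; exact: measurable_grid_cell.
Qed.

Lemma measurable_closed_rV (F : set 'rV[R]_d.+1) :
  closed F -> measurable (F : set (lebesgue_space R d)).
Proof.
by move=> cF; rewrite -(setCK F); apply/measurableC/measurable_open_rV/closed_openC.
Qed.

End lebesgue_measurable_sets.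

(** * Signed permutations and similarities *)

Definition signed_perm (d : nat) := ({ffun 'I_d -> bool} * {perm 'I_d})%type.

Section signed_perm_action.
Context {d : nat}.
Implicit Types w : signed_perm d.

(* [Wact] over any ring, so that it also acts on [Z^d]. *)
Definition wact {S : pzRingType} w (x : 'rV[S]_d) : 'rV[S]_d :=
  \row_i ((-1) ^+ w.1 i * x 0 (w.2 i)).

Definition wact_inv w : signed_perm d := ([ffun j => w.1 (w.2^-1%g j)], w.2^-1%g).

Definition signed_perm1 : signed_perm d := ([ffun=> false], 1%g).

Lemma wactK {S : pzRingType} w : cancel (@wact S w) (wact (wact_inv w)).
Proof. by move=> x; apply/rowP => i; rewrite !mxE ffunE permKV signrMK. Qed.

Lemma wactVK {S : pzRingType} w : cancel (wact (wact_inv w)) (@wact S w).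
Proof. by move=> x; apply/rowP => i; rewrite !mxE ffunE permK signrMK. Qed.

Lemma wact_bij {S : pzRingType} w : bijective (@wact S w).
Proof. by exists (wact (wact_inv w)); [exact: wactK|exact: wactVK]. Qed.

Lemma wact1 {S : pzRingType} (x : 'rV[S]_d) : wact signed_perm1 x = x.
Proof. by apply/rowP => i; rewrite mxE ffunE perm1 mul1r. Qed.

Lemma wactD {S : pzRingType} w : {morph @wact S w : x y / x + y}.
Proof. by move=> x y; apply/rowP => i; rewrite !mxE mulrDr. Qed.

Lemma wactZ {S : comPzRingType} w (l : S) x : wact w (l *: x) = l *: wact w x.
Proof. by apply/rowP => i; rewrite !mxE mulrCA. Qed.

Lemma zvec_wact {R : realType} w (t : 'rV[int]_d) : zvec R (wact w t) = wact w (zvec R t).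
Proof. by apply/rowP => i; rewrite !mxE rmorphM rmorph_sign. Qed.

Lemma sqnorm_wact {R : realType} w (x : vec R d) : sqnorm (wact w x) = sqnorm x.
Proof.
rewrite /sqnorm [RHS](reindex_inj (@perm_inj _ w.2)); apply: eq_bigr => i _.
by rewrite mxE exprMn sqrr_sign mul1r.
Qed.

Lemma norm_wact {R : realType} w (x : vec R d) : `|wact w x| = `|x|.
Proof.
have le_norm w' (y : vec R d) : `|wact w' y| <= `|y|.
  by apply/ler_rV_norm => // i; rewrite mxE normrM normr_sign mul1r ler_norm_coord.
by apply/le_anti; rewrite le_norm -{1}(wactK w x) le_norm.
Qed.

End signed_perm_action.

Lemma fine_EFinM {R : realType} (k : R) (X : \bar R) : fine (k%:E * X) = k * fine X.
Proof.
case: X => [x| |]//=; rewrite mulr0; case: (ltgtP 0 k) => [k0|k0|<-]; rewrite ?mul0e//.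
- by rewrite gt0_muley.
- by rewrite lt0_muley.
- by rewrite gt0_muleNy.
- by rewrite lt0_muleNy.
Qed.

Section similarities.
Context {R : realType} {d : nat}.
Implicit Types (w : signed_perm d) (v x : vec R d) (A : set (vec R d)).

Definition similarity (l : R) w v x : vec R d := l *: wact w x + v.

Lemma similarity_inverse (l : R) w v : l != 0 ->
  exists2 v', cancel (similarity l w v) (similarity l^-1 (wact_inv w) v') &
              cancel (similarity l^-1 (wact_inv w) v') (similarity l w v).
Proof.
move=> l0; exists (- (l^-1 *: wact (wact_inv w) v)) => x; rewrite /similarity.
  by rewrite wactD wactZ wactK scalerDr scalerA mulVf// scale1r addrK.
rewrite wactD -scaleN1r !wactZ !wactVK scaleN1r -scalerBr scalerA mulfV//.
by rewrite scale1r subrK.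
Qed.

Lemma lebesgue_outer_preimage_le (f : vec R d -> vec R d) (k : R) A : 0 < k ->
  (forall a b, exists a' b',
    f @^-1` box a b `<=` box a' b' /\ k * boxvol a' b' <= boxvol a b) ->
  (k%:E * lebesgue_outer (f @^-1` A) <= lebesgue_outer A)%E.
Proof.
move=> k0 fbox; apply: le_ereal_inf_tmp => _ [a [b [Aab ->]]].
have /choice[p pP] : forall n, exists p : vec R d * vec R d,
    f @^-1` box (a n) (b n) `<=` box p.1 p.2 /\ k * boxvol p.1 p.2 <= boxvol (a n) (b n).
  by move=> n; have [a' [b' ?]] := fbox (a n) (b n); exists (a', b').
apply: (@le_trans _ _ (k%:E * \sum_(0 <= n <oo) (boxvol (p n).1 (p n).2)%:E)%E).
  apply: lee_wpmul2l; first by rewrite lee_fin ltW.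
  apply: ereal_inf_lbound; exists (fst \o p), (snd \o p); split=> // x /Aab[n _ abx].
  by exists n => //; apply: (pP n).1.
rewrite -nneseriesZl; last by move=> n _; rewrite lee_fin boxvol_ge0.
apply: lee_nneseries => n *; rewrite -EFinM lee_fin; last exact: (pP n).2.
by rewrite mulr_ge0 ?boxvol_ge0// ltW.
Qed.

Lemma similarity_preimage_box (l : R) w v (a b : vec R d) : 0 < l ->
  exists a' b', similarity l w v @^-1` box a b `<=` box a' b' /\
    l ^+ d * boxvol a' b' <= boxvol a b.
Proof.
move=> l0; pose i j := w.2^-1%g j.
exists (\row_j ((if w.1 (i j) then v 0 (i j) - b 0 (i j) else a 0 (i j) - v 0 (i j)) / l)).
exists (\row_j ((if w.1 (i j) then v 0 (i j) - a 0 (i j) else b 0 (i j) - v 0 (i j)) / l)).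
split=> [x abx j|].
  have := abx (i j); rewrite !mxE permKV ler_pdivrMr// ler_pdivlMr// mulrC.
  by case: (w.1 _) => /andP[]; rewrite ?expr1 ?expr0 => ? ?; apply/andP; split; lra.
rewrite [leLHS](_ : _ = boxvol a b)// /boxvol -[in X in X * _](card_ord d) -prodr_const.
rewrite -big_split/= (reindex_inj (@perm_inj _ w.2))/=; apply: eq_bigr => j _.
rewrite !mxE /i permK maxr_pMr ?(ltW l0)// mulr0 -mulrBl mulrCA mulfV ?gt_eqF// mulr1.
by case: (w.1 j) => //; congr Num.max; ring.
Qed.

Lemma lebesgue_outer_similarity_le (l : R) w v A : 0 < l ->
  ((l ^+ d)%:E * lebesgue_outer (similarity l w v @^-1` A) <= lebesgue_outer A)%E.
Proof.
move=> l0; apply: lebesgue_outer_preimage_le; first by rewrite exprn_gt0.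
by move=> a b; exact: similarity_preimage_box.
Qed.

Lemma lebesgue_outer_similarity (l : R) w v A : 0 < l ->
  lebesgue_outer A = ((l ^+ d)%:E * lebesgue_outer (similarity l w v @^-1` A))%E.
Proof.
move=> l0; apply/le_anti; rewrite lebesgue_outer_similarity_le// andbT.
have [v' _ K] := similarity_inverse w v (lt0r_neq0 l0).
have linv0 : 0 < l^-1 by rewrite invr_gt0.
rewrite -lee_pdivrMl ?exprn_gt0// -exprVn.
apply: le_trans (lebesgue_outer_similarity_le (wact_inv w) v' _ linv0).
by rewrite -comp_preimage (_ : _ \o _ = id)//; apply/funext => x /=; rewrite K.
Qed.

Lemma lebesgue_outer_isometry w v A :
  lebesgue_outer (similarity 1 w v @^-1` A) = lebesgue_outer A.
Proof. by rewrite (lebesgue_outer_similarity w v A ltr01) expr1n mul1e. Qed.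

Lemma vol_similarity (l : R) w v A : 0 < l ->
  vol A = l ^+ d * vol (similarity l w v @^-1` A).
Proof.
by move=> l0; rewrite /vol (lebesgue_outer_similarity w v A l0) fine_EFinM.
Qed.

End similarities.

Lemma measurable_similarity {R : realType} {d} w (v : vec R d.+1) (A : set (vec R d.+1)) :
  measurable (A : set (lebesgue_space R d)) ->
  measurable (similarity 1 w v @^-1` A : set (lebesgue_space R d)).
Proof.
move=> mA; have [v' K _] := similarity_inverse w v (oner_neq0 R).
set f := similarity 1 w v; set g := similarity 1^-1 (wact_inv w) v' in K.
have isoE B : lebesgue_outer (f @^-1` B) = lebesgue_outer B by exact: lebesgue_outer_isometry.
have splitA : (@lebesgue_outer R d.+1).-caratheodory A := mA.
apply: le_caratheodory_measurable => X.
have -> : X = f @^-1` (g @^-1` X) by apply/seteqP; split=> x /=; rewrite K.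
by rewrite preimage_setC -!preimage_setI /= !isoE -splitA.
Qed.

(** * Volume of the unit cube *)

Lemma ge1_weighted_itv_cover {R : realType} (e p q : nat -> R) :
  (forall k, 0 <= e k) ->
  (forall t : R, 0 <= t < 1 -> (1 <= \sum_(0 <= k <oo) (e k * \1_`[p k, q k] t)%:E)%E) ->
  (1 <= \sum_(0 <= k <oo) (e k * Num.max (q k - p k) 0)%:E)%E.
Proof.
move=> e0 cover.
pose I01 : set (measurableTypeR R) := `[0%R, 1%R[%classic.
have mI01 : measurable I01 by exact: measurable_itv.
pose f k (t : measurableTypeR R) : \bar R := (e k * \1_`[p k, q k] t)%:E.
have mf k : measurable_fun I01 (f k).
  by apply/measurable_EFinP/measurable_funM => //; exact: measurable_indic.
have f_ge0 k t : (0 <= f k t)%E by rewrite lee_fin mulr_ge0.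
have int_f k : (\int[lebesgue_measure]_(t in I01) f k t <=
    (e k * Num.max (q k - p k) 0)%:E)%E.
  rewrite /f; under eq_integral do rewrite EFinM.
  rewrite ge0_integralZl_EFin//; last by apply/measurable_EFinP; exact: measurable_indic.
  rewrite integral_indic// EFinM; apply: lee_wpmul2l; rewrite ?lee_fin//.
  apply: (@le_trans _ _ (lebesgue_measure (`[p k, q k]%classic : set R))).
    by apply: le_measure; rewrite ?inE//; exact: measurableI.
  rewrite lebesgue_measure_itv/= lte_fin; case: ifPn => _.
    by rewrite lee_fin le_max lexx.
  by rewrite lee_fin le_max lexx orbT.
have <- : (\int[lebesgue_measure]_(t in I01) 1 = 1)%E.
  rewrite integral_cst// mul1e [LHS](lebesgue_measure_itv (`[0%R, 1%R[%R : interval R))/=.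
  by rewrite lte_fin ltr01 oppr0 adde0.
apply: (@le_trans _ _ (\int[lebesgue_measure]_(t in I01) \sum_(0 <= k <oo) f k t)%E).
  by apply: ge0_le_integral => //; exact: ge0_emeasurable_sum.
rewrite integral_nneseries//.
by apply: lee_nneseries => // k _ _; exact: integral_ge0.
Qed.

Definition unit_cube {R : realType} {d} : set (vec R d) := [set x | floor_rV x = 0].

Section unit_cube_volume.
Context {R : realType}.

Lemma unit_cubeE {d} (x : vec R d) : unit_cube x <-> forall i, 0 <= x 0 i < 1.
Proof.
split=> [/rowP x0 i|x01]; first by have := floor_itv (x 0 i); have := x0 i; rewrite !mxE => ->.
by apply/rowP => i; rewrite !mxE; apply: floor_def; rewrite add0r.
Qed.

Definition cons_rV {d} (t : R) (x : vec R d) : vec R d.+1 :=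
  \row_i oapp (x 0) t (unlift 0 i).

Lemma unit_cube_cons {d} (t : R) (x : vec R d) :
  0 <= t < 1 -> unit_cube x -> unit_cube (cons_rV t x).
Proof.
move=> t01 /unit_cubeE x01; apply/unit_cubeE => i.
by rewrite mxE; case: unliftP => //= j _; exact: x01.
Qed.

Lemma indic_box_cons {d} (a b : vec R d.+1) (t : R) (x : vec R d) :
  \1_(box a b) (cons_rV t x) =
  \1_`[a 0 0, b 0 0] t * \1_(box (col' 0 a) (col' 0 b)) x :> R.
Proof.
rewrite !indicE -natrM mulnb; congr (nat_of_bool _)%:R.
apply/idP/andP => [/set_mem abx|[/set_mem/= t_ab /set_mem/= x_ab]].
  split; apply: mem_set; first by have := abx 0; rewrite mxE unlift_none /= in_itv.
  by move=> i; have := abx (lift 0 i); rewrite !mxE liftK.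
apply: mem_set => i; rewrite mxE; case: unliftP => [j ->|->] /=.
  by have := x_ab j; rewrite !mxE.
by rewrite in_itv in t_ab.
Qed.

Lemma boxvol_recl {d} (a b : vec R d.+1) :
  boxvol a b = Num.max (b 0 0 - a 0 0) 0 * boxvol (col' 0 a) (col' 0 b).
Proof.
by rewrite /boxvol big_ord_recl; congr (_ * _); apply: eq_bigr => i _; rewrite !mxE.
Qed.

(* Integrating over one coordinate replaces its factor in the indicator of a box
   by the side length. *)
Lemma ge1_weighted_box_cover {d} (a b : nat -> vec R d) (c : nat -> R) :
  (forall k, 0 <= c k) ->
  (forall x, unit_cube x -> (1 <= \sum_(0 <= k <oo) (c k * \1_(box (a k) (b k)) x)%:E)%E) ->
  (1 <= \sum_(0 <= k <oo) (c k * boxvol (a k) (b k))%:E)%E.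
Proof.
elim: d => [|d IH] in a b c *.
  move=> _ cover; have /cover : unit_cube (0 : vec R 0) by apply/unit_cubeE => -[].
  congr (_ <= _)%E; apply: eq_eseriesr => k _.
  by rewrite indicE mem_set => [|[]//]; rewrite /boxvol big_ord0.
move=> c0 cover; pose len k := Num.max (b k 0 0 - a k 0 0) 0.
under eq_eseriesr do rewrite boxvol_recl mulrA.
apply: IH => [k|x x01]; first by rewrite mulr_ge0// le_max lexx orbT.
under eq_eseriesr do rewrite mulrAC.
apply: ge1_weighted_itv_cover => [k|t t01]; first by rewrite mulr_ge0.
under eq_eseriesr do rewrite -mulrA [X in _ * X]mulrC -indic_box_cons.
by apply: cover; exact: unit_cube_cons.
Qed.

Lemma lebesgue_outer_unit_cube {d} : lebesgue_outer (unit_cube : set (vec R d.+1)) = 1%E.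
Proof.
apply/le_anti/andP; split.
  have cube_box : unit_cube `<=` box 0 (const_mx 1 : vec R d.+1).
    by move=> x /unit_cubeE x01 i; rewrite !mxE; have /andP[-> /ltW] := x01 i.
  apply: (le_trans (le_lebesgue_outer cube_box)).
  apply: (le_trans (lebesgue_outer_box_le _ _)).
  by rewrite /boxvol big1// => i _; rewrite !mxE subr0 max_l.
apply: le_ereal_inf_tmp => _ [a [b [cover ->]]].
under eq_eseriesr do rewrite -[boxvol _ _]mul1r.
apply: ge1_weighted_box_cover => // x /cover[k _ abx].
rewrite (@nneseriesD1 _ _ k xpredT)// mul1r indicE mem_set// leeDl//.
by apply: nneseries_ge0 => j _ _; rewrite lee_fin mul1r.
Qed.

End unit_cube_volume.

(** * Countable and finitely supported sums *)

Lemma esum_countType {R : realType} {I : countType} (a : I -> \bar R) :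
  (forall i, 0 <= a i)%E ->
  (\esum_(i in [set: I]) a i = \sum_(0 <= k <oo) oapp a 0 (pickle_inv k))%E.
Proof.
move=> a0; have a0' k : (0 <= oapp a 0 (pickle_inv k : option I))%E.
  by case: pickle_inv => /=.
rewrite nneseries_esumT// [RHS](esumID (range (@pickle I)))// !setTI.
rewrite [X in (_ + X)%E]esum1 ?adde0 => [|k nk]; last first.
  case ik: pickle_inv => [i|//]; exfalso; apply: nk; exists i => //.
  by have := @pickle_invK I k; rewrite /ocancel ik.
rewrite esum_image; last by move=> i j _ _; exact: (pcan_inj pickleK_inv).
by apply: eq_esum => i _; rewrite pickleK_inv.
Qed.

Section integral_of_countable_sums.
Context d (T : measurableType d) (R : realType) (mu : {measure set T -> \bar R}).
Context (I : countType) (D : set T) (f : I -> T -> \bar R).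
Hypotheses (mD : measurable D) (mf : forall i, measurable_fun D (f i)).
Hypothesis f0 : forall i x, (0 <= f i x)%E.

Lemma measurable_fun_esum : measurable_fun D (fun x => \esum_(i in [set: I]) f i x)%E.
Proof.
under eq_fun do rewrite esum_countType//.
apply: ge0_emeasurable_sum => k; first by move=> x _ _; case: pickle_inv => /=.
by case: pickle_inv => [i|] /= _; [exact: mf|exact: measurable_cst].
Qed.

Lemma integral_esum :
  (\int[mu]_(x in D) (\esum_(i in [set: I]) f i x) =
   \esum_(i in [set: I]) \int[mu]_(x in D) f i x)%E.
Proof.
under eq_integral do rewrite esum_countType//.
rewrite integral_nneseries// => [|k|k x _]; last 2 first.
- by case: pickle_inv => [i|] /=; [exact: mf|exact: measurable_cst].
- by case: pickle_inv => /=.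
rewrite esum_countType => [|i]; last exact: integral_ge0.
apply: eq_eseriesr => k _; case: pickle_inv => //=.
exact: integral0.
Qed.

End integral_of_countable_sums.

Lemma esum_measureI d (T : measurableType d) (R : realType) (mu : {measure set T -> \bar R})
    (I : countType) (A : I -> set T) (B : set T) (c : R) :
  measurable B -> (forall i, measurable (A i)) ->
  {ae mu, forall x, \esum_(i in [set: I]) (\1_(A i) x : R)%:E = c%:E} ->
  (\esum_(i in [set: I]) mu (B `&` A i) = c%:E * mu B)%E.
Proof.
move=> mB mA sum_c.
have mf i : measurable_fun B (fun x => (\1_(A i) x : R)%:E).
  by apply/measurable_EFinP; exact: measurable_indic.
rewrite -integral_cst//.
transitivity (\int[mu]_(x in B) (\esum_(i in [set: I]) (\1_(A i) x : R)%:E))%E.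
  rewrite integral_esum//; apply: eq_esum => i _.
  by rewrite integral_indic// setIC.
apply: ae_eq_integral => //; first exact: measurable_fun_esum.
by apply: filterS sum_c => x xc _.
Qed.

Lemma esum_indic_fiber {R : realType} {T : Type} {I : choiceType} (f : T -> I) (x : T) :
  (\esum_(i in [set: I]) (\1_(f @^-1` [set i]) x : R)%:E = 1)%E.
Proof.
rewrite (esumID [set f x])// !setTI esum_set1 ?lee_fin// indicE mem_set//.
rewrite esum1 ?adde0// => i /= ifx.
by rewrite indicE memNset//= => fxi; apply: ifx.
Qed.

Lemma fsbig_finType {V : Type} {idx : V} {op : Monoid.com_law idx} {I : finType}
    (F : I -> V) :
  \big[op/idx]_(i \in [set: I]) F i = \big[op/idx]_i F i.
Proof.
rewrite (fsbigE (index_enum I))//; last by move=> i _; rewrite mem_index_enum.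
  by rewrite big_mkcond/=; apply: eq_bigr => i _; rewrite in_setT.
exact: index_enum_uniq.
Qed.

Lemma fsbig_pair_finType {V : nmodType} {I : finType} {J : choiceType} (F : I * J -> V) :
  finite_set [set p | F p != 0] ->
  \sum_(p \in [set: I * J]) F p = \sum_i \sum_(j \in [set: J]) F (i, j).
Proof.
move=> finF; pose Q := snd @` [set p | F p != 0].
have F0 i j : ~ Q j -> F (i, j) = 0.
  by move=> Qj; apply: contrapT => /eqP Fij; apply: Qj; exists (i, j).
transitivity (\sum_(p \in [set: I] `*` Q) F p).
  by apply/esym/fsbig_widen => // -[i j] [_ /=] nQ; apply: F0 => Qj; apply: nQ.
transitivity (\sum_(i \in [set: I]) \sum_(j \in Q) F (i, j)).
  rewrite pair_fsbig; first by apply: eq_fsbigr => -[].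
    exact: finite_finset.
  exact: finite_image.
rewrite fsbig_finType; apply: eq_bigr => i _; apply: fsbig_widen => // j [_ nQ] /=.
exact: F0.
Qed.

Lemma raddf_fsbig {U V : nmodType} {I : choiceType} (f : {additive U -> V}) (a : I -> U) :
  finite_set [set i | a i != 0] ->
  f (\sum_(i \in [set: I]) a i) = \sum_(i \in [set: I]) f (a i).
Proof.
move=> fin_a; have a0 i : ~ [set i | a i != 0] i -> a i = 0.
  by move=> ai; apply: contrapT => /eqP.
rewrite -(fsbig_widen [set i | a i != 0])// => [|i [_ /a0]//].
rewrite -[RHS](fsbig_widen [set i | a i != 0])// => [|i [_ /a0 /= ->]]; last exact: raddf0.
by rewrite !fsbig_finite// raddf_sum.
Qed.

Lemma esum_fsbig {R : realType} {I : choiceType} (a : I -> R) :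
  (forall i, 0 <= a i) -> finite_set [set i | a i != 0] ->
  (\esum_(i in [set: I]) (a i)%:E = (\sum_(i \in [set: I]) a i)%:E)%E.
Proof.
move=> a0 fin_a; rewrite (esumID [set i | a i != 0]); last by move=> i _; rewrite lee_fin.
rewrite !setTI [X in (_ + X)%E]esum1 ?adde0 => [|i /= /negP/negPn/eqP ->//].
rewrite esum_fset//; last by move=> i _; rewrite lee_fin.
rewrite fsumEFin//; congr EFin; apply: fsbig_widen => // i [_ /= ai].
by apply: contrapT => /eqP.
Qed.

Lemma esum_pair_finType {R : realType} {I : finType} {J : choiceType} (a : I * J -> \bar R) :
  (forall p, 0 <= a p)%E ->
  (\esum_(p in [set: I * J]) a p = \sum_i \esum_(j in [set: J]) a (i, j))%E.
Proof.
move=> a0; rewrite -fsbig_finType -esum_fset; last 2 first.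
- exact: finite_finset.
- by move=> i _; exact: esum_ge0.
rewrite esum_esum => [|i j _ _]; last exact: a0.
have -> : [set: I] `*`` (fun=> [set: J]) = setT by apply/seteqP.
by apply: eq_esum => -[].
Qed.

(** * Finitely generated cones *)

Section cones.
Context {F : realFieldType} {N d : nat}.
Implicit Types (U : 'M[F]_(N, d)) (c : 'rV[F]_N).

Definition supp c : {set 'I_N} := [set i | c 0 i != 0].

Definition independent_rows U (S : {set 'I_N}) :=
  forall c, supp c \subset S -> c *m U = 0 -> c = 0.

Lemma supp_out c (S : {set 'I_N}) i : supp c \subset S -> i \notin S -> c 0 i = 0.
Proof. by move=> /fintype.subsetP cS; apply: contraNeq => ci; apply: cS; rewrite inE. Qed.

Lemma suppB_sub c c' (t : F) (S : {set 'I_N}) :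
  supp c \subset S -> supp c' \subset S -> supp (c - t *: c') \subset S.
Proof.
move=> cS c'S; apply/fintype.subsetP => i; rewrite inE; apply: contraNT => iS.
by rewrite !mxE (supp_out cS)// (supp_out c'S)// mulr0 subr0.
Qed.

(* Subtract the largest multiple of [m] that keeps the coefficients nonnegative. *)
Lemma drop_dependent_generator U c m : (forall i, 0 <= c 0 i) ->
  supp m \subset supp c -> m *m U = 0 -> (exists i, 0 < m 0 i) ->
  exists c', [/\ forall i, 0 <= c' 0 i, c' *m U = c *m U & supp c' \proper supp c].
Proof.
move=> c0 mc mU [i1 mi1].
have [i0 /= mi0 min_i0] :=
  @arg_minP _ _ _ i1 (fun i => 0 < m 0 i) (fun i => c 0 i / m 0 i) mi1.
pose t := c 0 i0 / m 0 i0; have t0 : 0 <= t by rewrite divr_ge0// ltW.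
exists (c - t *: m); split=> [i||].
- rewrite !mxE subr_ge0; have [mi|mi] := ltP 0 (m 0 i).
    by rewrite -ler_pdivlMr//; exact: min_i0.
  by apply: (le_trans _ (c0 i)); rewrite mulr_ge0_le0.
- by rewrite mulmxBl -scalemxAl mU scaler0 subr0.
- apply/properP; split; first exact: suppB_sub.
  exists i0; first by apply: (fintype.subsetP mc); rewrite inE gt_eqF.
  by rewrite inE negbK !mxE divfK ?subrr// gt_eqF.
Qed.

Lemma cone_caratheodory U c : (forall i, 0 <= c 0 i) ->
  exists c', [/\ forall i, 0 <= c' 0 i, c' *m U = c *m U & independent_rows U (supp c')].
Proof.
have [n] := ubnP #|supp c|; elim: n c => // n IH c /ltnSE le_n c0.
have [indep|] := pselect (independent_rows U (supp c)); first by exists c.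
move=> /existsNP[m /not_implyP[mc /not_implyP[mU /eqP/rV0Pn[k mk]]]].
suff [m' [m'c m'U m'0]] : exists m', [/\ supp m' \subset supp c, m' *m U = 0
    & exists i, 0 < m' 0 i].
  have [c1 [c1_ge0 c1U c1c]] := drop_dependent_generator c0 m'c m'U m'0.
  have [c2 [c2_ge0 c2U indep]] := IH c1 (leq_trans (proper_card c1c) le_n) c1_ge0.
  by exists c2; rewrite c2U.
move: mk; rewrite neq_lt => /orP[mk|mk]; last by exists m; split=> //; exists k.
exists (- m); split; last by exists k; rewrite mxE oppr_gt0.
- by apply: fintype.subset_trans mc; apply/fintype.subsetP => i; rewrite !inE mxE oppr_eq0.
- by rewrite mulNmx mU oppr0.
Qed.

Lemma independent_rows_linv U (S : {set 'I_N}) : independent_rows U S ->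
  exists B : 'M[F]_(d, N), forall c, supp c \subset S -> c = c *m U *m B.
Proof.
move=> indep; pose D : 'M[F]_N := diag_mx (\row_i (i \in S)%:R).
have supp_mulD c : supp (c *m D) \subset S.
  apply/fintype.subsetP => i; rewrite inE mul_mx_diag !mxE.
  by case: (i \in S); rewrite ?mulr0 ?eqxx.
have mulD_id c : supp c \subset S -> c *m D = c.
  move=> cS; apply/rowP => i; rewrite mul_mx_diag !mxE.
  by case: (boolP (i \in S)) => iS; rewrite ?mulr1// (supp_out cS) ?mul0r.
pose A := D *m U; exists (pinvmx A *m D) => c cS; apply/eqP; rewrite -subr_eq0; apply/eqP.
apply: indep; first by rewrite -[X in _ - X]scale1r suppB_sub// mulmxA.
have cA : c *m U = c *m A by rewrite mulmxA mulD_id.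
rewrite mulmxBl [X in _ - X](_ : _ = c *m U *m pinvmx A *m A); last by rewrite !mulmxA.
by rewrite mulmxKpV ?subrr// cA submxMl.
Qed.

End cones.

Section cone_coefficients.
Context {R : realType} {N d : nat}.

Lemma norm_mulmx_le (B : 'M[R]_(d, N)) :
  exists2 K : R, 0 <= K & forall x : 'rV[R]_d, `|x *m B| <= K * `|x|.
Proof.
pose K := \sum_j \sum_i `|B i j|.
have K0 : 0 <= K by apply: sumr_ge0 => j _; exact: sumr_ge0.
exists K => // x; apply/ler_rV_norm; rewrite ?mulr_ge0// => j.
rewrite mxE /K (bigD1 j)//= mulrDl ler_wpDr//.
  by rewrite mulr_ge0// sumr_ge0// => k _; rewrite sumr_ge0.
apply: (le_trans (ler_norm_sum _ _ _)); rewrite mulr_suml; apply: ler_sum => i _.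
by rewrite normrM mulrC ler_wpM2l// ler_norm_coord.
Qed.

Lemma cone_coefficient_bound (U : 'M[R]_(N, d)) :
  exists2 K : R, 0 <= K & forall c : 'rV[R]_N, (forall i, 0 <= c 0 i) ->
    exists c' : 'rV[R]_N,
      [/\ forall i, 0 <= c' 0 i, c' *m U = c *m U & `|c'| <= K * `|c *m U|].
Proof.
have /choice[K KP] (S : {set 'I_N}) : exists K : R, 0 <= K /\
    (independent_rows U S -> forall c : 'rV[R]_N, supp c \subset S -> `|c| <= K * `|c *m U|).
  have [/independent_rows_linv[B BP]|dep] := pselect (independent_rows U S); last by exists 0.
  have [K K0 KP] := norm_mulmx_le B; exists K; split=> // _ c cS.
  by rewrite {1}(BP _ cS).
exists (\sum_S K S) => [|c c0]; first by apply: sumr_ge0 => S _; case: (KP S).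
have [c' [c'0 c'U indep]] := cone_caratheodory U c0; exists c'; split=> //.
have [_ /(_ indep c' (subxx _)) c'K] := KP (supp c'); rewrite -c'U (le_trans c'K)//.
rewrite ler_wpM2r// (bigD1 (supp c'))//= lerDl.
by apply: sumr_ge0 => S _; case: (KP S).
Qed.

End cone_coefficients.

(** * Lattice polytopes *)

Lemma compact_normed_closed {R : numFieldType} {V : normedModType R} (A : set V) :
  compact A -> closed A.
Proof. by apply: compact_closed; exact: norm_hausdorff. Qed.

Lemma compact_norm_le {R : realType} {V : normedModType R} (A : set V) :
  compact A -> exists M : R, forall x, A x -> `|x| <= M.
Proof.
by move=> /compact_bounded[M [_ AM]]; exists (M + 1) => x /AM; apply; rewrite ltrDl.
Qed.

Section simplex.
Context {R : realType} {N : nat}.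

Definition simplex : set 'rV[R]_N := [set l | (forall i, 0 <= l 0 i) /\ \sum_i l 0 i = 1].

Lemma simplex_le1 l i : simplex l -> l 0 i <= 1.
Proof. by move=> [l0 <-]; rewrite (bigD1 i)//= lerDl sumr_ge0. Qed.

Lemma continuous_coord (i : 'I_N) : continuous (fun l : 'rV[R]_N => l 0 i).
Proof. exact: coord_continuous. Qed.

Lemma compact_simplex : compact simplex.
Proof.
apply: bounded_closed_compact.
  exists 1; split=> // M M1 l l_simplex; apply: (le_trans _ (ltW M1)).
  by apply/ler_rV_norm => // i; rewrite ger0_norm ?simplex_le1//; case: l_simplex.
have -> : simplex = (\bigcap_(i in [set: 'I_N])
      ((fun l : 'rV[R]_N => l 0 i) @^-1` [set t | 0 <= t])) `&`
    ((fun l : 'rV[R]_N => \sum_i l 0 i) @^-1` [set 1]).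
  by apply/seteqP; split=> l [l0 l1]; split=> // i; [move=> _|]; exact: l0.
apply: closedI.
  apply: closed_bigI => i _; apply: preimage_closed; last exact: closed_ge.
  by move=> l _; exact: continuous_coord.
apply: preimage_closed; last exact: closed_eq.
move=> l _; apply: continuous_big; first exact: add_continuous.
by move=> i _; exact: continuous_coord.
Qed.

End simplex.

Definition locally_conic {R : realType} {d} (P : set (vec R d)) (x : vec R d) :=
  \forall y \near (0 : 'rV[R]_d), forall t : R, 0 < t <= 1 -> P (x + y) <-> P (x + t *: y).

Lemma locally_conic_notin {R : realType} {d} (P : set 'rV[R]_d) (x : 'rV[R]_d) :
  closed P -> ~ P x -> locally_conic P x.
Proof.
move=> /closed_openC oP Px.
have /nbhs_ballP[e /= e0 xeP] : nbhs x (~` P) by exact: open_nbhs_nbhs.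
have {}xeP y : `|y| < e -> ~ P (x + y).
  by move=> ye; apply: xeP; rewrite -ball_normE/= opprD addNKr normrN.
near=> y => t /andP[t0 t1]; have ye : `|y| < e by near: y; exact: cvgr0_norm_lt.
split=> [/(xeP _ ye)//|]; suff /xeP : `|t *: y| < e by [].
by rewrite normrZ gtr0_norm// (le_lt_trans _ ye)// ler_piMl.
Unshelve. all: by end_near. Qed.

Section lattice_hull.
Context {R : realType} {d : nat} (V : seq 'rV[int]_d).
Let P : set 'rV[R]_d := lattice_hull (R := R) V.
Let v i : 'rV[R]_d := zvec R (tnth (in_tuple V) i).

Lemma compact_lattice_hull : compact P.
Proof.
have -> : P = (fun l : 'rV[R]_(size V) => \sum_i l 0 i *: v i) @` simplex.
  apply/seteqP; split=> [x [l [l0 [l1 ->]]]|_ [l [l0 l1] <-]]; last first.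
    by exists (fun i => l 0 i).
  exists (\row_i l i); last by apply: eq_bigr => i _; rewrite mxE.
  by split=> [i|]; [rewrite mxE|rewrite -l1; apply: eq_bigr => i _; rewrite mxE].
apply: continuous_compact; last exact: compact_simplex.
apply: continuous_subspaceT; apply: continuous_big; first exact: add_continuous.
by move=> i _ l; exact: (cvgZr_tmp (@continuous_coord _ _ i l)).
Qed.

Lemma lattice_hull_add_cone (x : vec R d) (c : 'I_(size V) -> R) : P x ->
  (forall i, 0 <= c i) -> \sum_i c i <= 1 -> P (x + \sum_i c i *: (v i - x)).
Proof.
move=> [l [l0 [l1 xE]]] c0 c1; set s := \sum_i c i in c1.
exists (fun i => (1 - s) * l i + c i); split; [|split].
- by move=> i; rewrite addr_ge0// mulr_ge0// subr_ge0.
- by rewrite big_split/= -mulr_sumr l1 mulr1 -/s subrK.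
under eq_bigr do rewrite scalerBr; rewrite sumrB -scaler_suml -/s.
under [in RHS]eq_bigr do rewrite scalerDl -scalerA; rewrite big_split/= -scaler_sumr -xE.
by rewrite scalerBl scale1r addrA addrAC.
Qed.

Lemma lattice_hull_displacement (x y : vec R d) : P (x + y) ->
  exists l : 'I_(size V) -> R,
    [/\ forall i, 0 <= l i, \sum_i l i = 1 & y = \sum_i l i *: (v i - x)].
Proof.
move=> [l [l0 [l1 xyE]]]; exists l; split=> //.
under eq_bigr do rewrite scalerBr; rewrite sumrB -scaler_suml l1 scale1r -xyE.
by rewrite addrAC subrr add0r.
Qed.

Lemma lattice_hull_locally_conic (x : vec R d) : locally_conic P x.
Proof.
have [Px|] := pselect (P x); last first.
  by apply: locally_conic_notin; apply: compact_normed_closed; exact: compact_lattice_hull.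
pose U : 'M[R]_(size V, d) := \matrix_i (v i - x).
have mulU (c : 'rV[R]_(size V)) : c *m U = \sum_i c 0 i *: (v i - x).
  by rewrite mulmx_sum_row; apply: eq_bigr => i _; rewrite rowK.
have [K K0 KP] := cone_coefficient_bound U.
pose k := (size V)%:R * K + 1; have k0 : 0 < k by rewrite ltr_wpDl// mulr_ge0.
near=> y => t /andP[t0 t1]; split=> [/lattice_hull_displacement[l [l0 l1 ->]]|].
  rewrite scaler_sumr; under eq_bigr do rewrite scalerA.
  apply: lattice_hull_add_cone => // [i|]; first by rewrite mulr_ge0// ltW.
  by rewrite -mulr_sumr l1 mulr1.
move=> /lattice_hull_displacement[l [l0 _ tyE]].
have yE : y = (\row_i (t^-1 * l i)) *m U.
  rewrite mulU; under eq_bigr do rewrite mxE -scalerA.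
  by rewrite -scaler_sumr -tyE scalerA mulVf ?scale1r// gt_eqF.
have [|c [c0 cU c_le]] := KP (\row_i (t^-1 * l i)).
  by move=> i; rewrite mxE mulr_ge0// invr_ge0 ltW.
rewrite yE -cU mulU; apply: lattice_hull_add_cone => //; rewrite -yE in c_le.
apply: (@le_trans _ _ (\sum_(i < size V) K * `|y|)).
  by apply: ler_sum => i _; rewrite (le_trans (ler_norm _))// (le_trans (ler_norm_coord _ _)).
rewrite sumr_const card_ord -[leLHS]mulr_natl mulrA.
apply: (@le_trans _ _ (k * `|y|)); first by rewrite ler_wpM2r// lerDl.
rewrite mulrC -ler_pdivlMr// div1r ltW//; near: y.
by apply: cvgr0_norm_lt => //; rewrite invr_gt0.
Unshelve. all: by end_near. Qed.

End lattice_hull.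

(** * Solid angles *)

Lemma near_right0E {R : realFieldType} (Q : set R) :
  (\forall r \near 0^'+, Q r) <->
  exists r0 : R, 0 < r0 /\ forall r : R, 0 < r -> r < r0 -> Q r.
Proof.
split=> [[r0 /= r0_gt0 Qr]|[r0 [r0_gt0 Qr]]].
  exists r0; split=> // r r_gt0 rr0; apply: Qr => //=.
  by rewrite sub0r normrN gtr0_norm.
by near=> r; apply: Qr; near: r; [exact: nbhs_right_gt|exact: nbhs_right_lt].
Unshelve. all: by end_near. Qed.

Lemma near_right0_scale {R : realFieldType} (l : R) (Q : set R) : 0 < l ->
  (\forall r \near 0^'+, Q r) -> \forall r \near 0^'+, Q (l * r).
Proof.
move=> l0 /near_right0E[r0 [r0_gt0 Qr]]; apply/near_right0E.
exists (r0 / l); split=> [|r r_gt0]; first exact: divr_gt0.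
by rewrite ltr_pdivlMr// mulrC; apply: Qr; exact: mulr_gt0.
Qed.

Section euclidean_norm.
Context {R : realType} {d : nat}.
Implicit Types x y : vec R d.

Lemma sqnormZ (t : R) x : sqnorm (t *: x) = t ^+ 2 * sqnorm x.
Proof. by rewrite /sqnorm mulr_sumr; apply: eq_bigr => i _; rewrite mxE exprMn. Qed.

Lemma norm_lt_sqnorm x (r : R) : 0 < r -> sqnorm x < r ^+ 2 -> `|x| < r.
Proof.
move=> r0 xr; apply/ltr_rV_norm => // i.
rewrite -ltr_sqr ?nnegrE ?(ltW r0)// real_normK ?num_real//; apply: le_lt_trans xr.
by rewrite /sqnorm (bigD1 i)//= lerDl; apply: sumr_ge0 => j _; exact: sqr_ge0.
Qed.

Lemma sqnorm_le_norm x : sqnorm x <= d%:R * `|x| ^+ 2.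
Proof.
rewrite -[X in X%:R * _](card_ord d) mulr_natl -sumr_const; apply: ler_sum => i _.
by rewrite -real_normK ?num_real// lerXn2r ?nnegrE// ler_norm_coord.
Qed.

Lemma eball_similarity (l : R) w v x (r : R) : 0 < l ->
  similarity l w v @^-1` eball (similarity l w v x) (l * r) = eball x r.
Proof.
move=> l0; apply/funext => y; rewrite /eball/= /similarity opprD addrACA subrr addr0.
rewrite -scalerBr sqnormZ exprMn -scaleN1r -wactZ -wactD scaleN1r sqnorm_wact.
by rewrite ltr_pM2l// exprn_gt0.
Qed.

Lemma near_eball_sub (U : set 'rV[R]_d) x : (\forall y \near x, U y) ->
  \forall r \near 0^'+, eball x r `<=` U.
Proof.
move=> /nbhs_ballP[e /= e0 xeU]; near=> r => y yr; apply: xeU.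
rewrite -ball_normE/= distrC (lt_trans (norm_lt_sqnorm _ yr))//.
Unshelve. all: by end_near. Qed.

End euclidean_norm.

Lemma open_eball {R : realType} {d} (x : vec R d) r : open (eball x r : set 'rV[R]_d).
Proof.
have sqnorm_cont : continuous (fun y : 'rV[R]_d => sqnorm (y - x)).
  apply: continuous_big => [|i _ y]; first exact: add_continuous.
  rewrite /=; under eq_fun do rewrite !mxE expr2.
  have yx : (fun z : 'rV[R]_d => z 0 i - x 0 i) z @[z --> y] --> y 0 i - x 0 i.
    exact: (cvgB (@continuous_coord R d i y) (cvg_cst _)).
  exact: (cvgM yx yx).
rewrite (_ : eball x r = (fun y : 'rV[R]_d => sqnorm (y - x)) @^-1` [set t | t < r ^+ 2])//.
by apply: open_comp => [y _|]; [exact: sqnorm_cont|exact: open_lt].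
Qed.

Lemma lebesgue_outer_bounded_fin_num {R : realType} {d} (M : R) (A : set (vec R d.+1)) :
  (forall x : vec R d.+1, A x -> `|x| <= M) -> lebesgue_outer A \is a fin_num.
Proof.
move=> AM; rewrite ge0_fin_numE; last exact: lebesgue_outer_ge0.
have A_box : A `<=` box (const_mx (- M)) (const_mx M : vec R d.+1).
  by move=> x /AM xM i; rewrite !mxE -ler_norml (le_trans (ler_norm_coord _ _)).
apply: (le_lt_trans (le_lebesgue_outer A_box)).
by apply: (le_lt_trans (lebesgue_outer_box_le _ _)); rewrite ltry.
Qed.

Lemma lebesgue_outer_eball_fin_num {R : realType} {d} (x : vec R d.+1) (r : R) A :
  0 < r -> A `<=` eball x r -> lebesgue_outer A \is a fin_num.
Proof.
move=> r0 Ax; apply: (@lebesgue_outer_bounded_fin_num _ _ (r + `|x|)) => y /Ax yr.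
rewrite -{1}(subrK x y) (le_trans (ler_normD _ _))// lerD2r ltW//.
exact: norm_lt_sqnorm yr.
Qed.

Lemma vol_eball_gt0 {R : realType} {d} (x : vec R d.+1) (r : R) :
  0 < r -> 0 < vol (eball x r).
Proof.
move=> r0; pose s := r / d.+2%:R; have s0 : 0 < s by rewrite divr_gt0.
rewrite fine_gt0//; apply/andP; split; last first.
  by rewrite ltey_eq (@lebesgue_outer_eball_fin_num _ _ x r).
rewrite (lebesgue_outer_similarity signed_perm1 x _ s0).
rewrite mule_gt0 ?lte_fin ?exprn_gt0//.
apply: (@lt_le_trans _ _ 1%E); first by rewrite lte_fin.
rewrite -(@lebesgue_outer_unit_cube R d); apply: le_lebesgue_outer => y /unit_cubeE y01.
have y1 : `|y| <= 1.
  by apply/ler_rV_norm => // i; have /andP[? /ltW] := y01 i; rewrite ger0_norm.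
rewrite /= /similarity wact1 /eball/= addrK sqnormZ.
apply: (@le_lt_trans _ _ (s ^+ 2 * d.+1%:R)).
  rewrite ler_wpM2l ?sqr_ge0// (le_trans (sqnorm_le_norm _))//.
  by rewrite ler_piMr// expr_le1.
rewrite /s exprMn -mulrA -[ltRHS]mulr1 ltr_pM2l ?exprn_gt0//.
rewrite exprVn mulrC ltr_pdivrMr ?exprn_gt0// mul1r -natrX ltr_nat.
by rewrite expnS expn1 mulnS ltn_addr.
Qed.

Definition ball_density {R : realType} {d} (P : set (vec R d)) (x : vec R d) (r : R) : R :=
  vol (eball x r `&` P) / vol (eball x r).

Definition has_solid_angle {R : realType} {d} (P : set (vec R d)) (x : vec R d) :=
  \forall r \near 0^'+, ball_density P x r = solid_angle P x.

Section solid_angle.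
Context {R : realType} {d : nat}.
Implicit Types (P : set (vec R d)) (x : vec R d).

Lemma solid_angleE P x :
  solid_angle P x = xget 0 [set a | \forall r \near 0^'+, ball_density P x r = a].
Proof. by congr (xget 0 _); apply/seteqP; split=> a /near_right0E. Qed.

Lemma near_solid_angleE P x (a : R) :
  (\forall r \near 0^'+, ball_density P x r = a) -> solid_angle P x = a.
Proof.
move=> Pa; rewrite solid_angleE; apply: xget_subset1 => // b c Pb Pc.
near (0 : R)^'+ => r; have <- : ball_density P x r = b by near: r.
by near: r.
Unshelve. all: by end_near. Qed.

Lemma ball_density_similarity (l : R) w v P x (r : R) : 0 < l ->
  ball_density (similarity l w v @^-1` P) x r =
  ball_density P (similarity l w v x) (l * r).
Proof.
move=> l0; rewrite /ball_density -(eball_similarity w v x r l0) -preimage_setI.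
rewrite (vol_similarity w v (_ `&` P) l0) (vol_similarity w v (eball _ (l * r)) l0).
by rewrite -mulf_div divff ?mul1r// expf_neq0// gt_eqF.
Qed.

Lemma solid_angle_similarity (l : R) w v P x : 0 < l ->
  solid_angle (similarity l w v @^-1` P) x = solid_angle P (similarity l w v x).
Proof.
move=> l0; rewrite !solid_angleE; congr (xget 0 _); apply/seteqP; split=> a.
  have linv0 : 0 < l^-1 by rewrite invr_gt0.
  move=> /(near_right0_scale linv0); apply: filterS => r <-.
  by rewrite ball_density_similarity// mulVKf// gt_eqF.
by move=> /(near_right0_scale l0); apply: filterS => r <-; exact: ball_density_similarity.
Qed.

Lemma solid_angle_dilate P (n : R) x : 0 < n ->
  solid_angle (dilate n P) x = solid_angle P (n^-1 *: x).
Proof.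
move=> n0; have simE y : similarity n^-1 signed_perm1 0 y = n^-1 *: y.
  by rewrite /similarity wact1 addr0.
rewrite -simE -solid_angle_similarity ?invr_gt0//; congr (solid_angle _ x).
apply/seteqP; split=> [_ [y Py <-]|y] /=; rewrite simE.
  by rewrite scalerA mulVf ?scale1r// gt_eqF.
by move=> Py; exists (n^-1 *: y) => //; rewrite scalerA mulfV ?scale1r// gt_eqF.
Qed.

(* The homothety of centre [x] and ratio [l <= 1] fixes [P] near [x]. *)
Lemma locally_conic_has_solid_angle P x : locally_conic P x -> has_solid_angle P x.
Proof.
move=> conicP; suff [a Pa] : exists a, \forall r \near 0^'+, ball_density P x r = a.
  by rewrite /has_solid_angle (near_solid_angleE Pa).
have /near_right0E[r0 [r0_gt0 conic_r0]] := near_eball_sub conicP.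
pose s := r0 / 2; have s0 : 0 < s by rewrite divr_gt0.
have sr0 : s < r0 by rewrite ltr_pdivrMr// ltr_pMr// ltr1n.
exists (ball_density P x s); apply/near_right0E; exists s; split=> // r r_gt0 rs.
pose l := r / s; have l0 : 0 < l by rewrite divr_gt0.
have l1 : l <= 1 by rewrite ler_pdivrMr// mul1r ltW.
pose h := similarity l signed_perm1 (x - l *: x).
have hE y : h y = x + l *: (y - x) by rewrite /h /similarity wact1 scalerBr addrCA.
have hx : h x = x by rewrite hE subrr scaler0 addr0.
have Ph y : eball x s y -> P y <-> P (h y).
  move=> ys; rewrite hE -{1}(subrKC x y); apply: (conic_r0 s s0 sr0); rewrite ?l0//.
  by rewrite /eball/= subr0.
have -> : r = l * s by rewrite divfK// gt_eqF.
rewrite -[X in ball_density P X (l * s)]hx -ball_density_similarity//; congr (vol _ / _).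
by apply/seteqP; split=> y [ys Py]; split=> //; apply/(Ph y ys).
Qed.

End solid_angle.

Lemma ball_density_disjoint {R : realType} {d} (P : set (vec R d.+1)) x (r : R) :
  eball x r `&` P = set0 -> ball_density P x r = 0.
Proof. by rewrite /ball_density => ->; rewrite /vol lebesgue_outer0 mul0r. Qed.

Lemma solid_angle_notin {R : realType} {d} (P : set 'rV[R]_d.+1) (x : 'rV[R]_d.+1) :
  closed P -> ~ P x -> solid_angle P x = 0.
Proof.
move=> /closed_openC oP Px; apply: near_solid_angleE.
have /near_eball_sub : \forall y \near x, (~` P) y by exact: open_nbhs_nbhs.
by apply: filterS => r /disjoints_subset; exact: ball_density_disjoint.
Qed.

Lemma near_finite_set {T : Type} {I : choiceType} {F : set_system T} {FF : Filter F}
    (A : set I) (Q : I -> set T) :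
  finite_set A -> (forall i, A i -> \forall x \near F, Q i x) ->
  \forall x \near F, forall i, A i -> Q i x.
Proof.
move=> finA AQ; apply: filterS (@filter_bigI _ _ (fset_set A) Q F FF _).
  by move=> x AQx i Ai; apply: AQx; rewrite /= in_fset_set//; exact: mem_set.
by move=> i; rewrite in_fset_set// => /set_mem; exact: AQ.
Qed.

(* Far from [P] both sides vanish, so only finitely many radii are constrained. *)
Lemma near_forall_ball_densityE {R : realType} {d} {I : choiceType} (P : set 'rV[R]_d.+1)
    (z : I -> 'rV[R]_d.+1) :
  compact P -> (forall x, has_solid_angle P x) ->
  (forall C : R, finite_set [set i | `|z i| <= C]) ->
  \forall r \near 0^'+, forall i, ball_density P (z i) r = solid_angle P (z i).
Proof.
move=> P_compact P_angle fin_z; have [M PM] := compact_norm_le P_compact.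
pose F := [set i | `|z i| <= M + 1].
have near_F : \forall r \near 0^'+, forall i, F i ->
    ball_density P (z i) r = solid_angle P (z i).
  by apply: near_finite_set => [|i _]; [exact: fin_z|exact: P_angle].
near=> r; have [r0 r1] : 0 < r /\ r < 1.
  by split; near: r; [exact: nbhs_right_gt|exact: nbhs_right_lt].
move=> i; have [Fi|/negP] := pselect (F i); first by move: i Fi; near: r.
rewrite -ltNge => Fi; rewrite solid_angle_notin; first last.
- by move=> /PM; apply/negP; rewrite -ltNge (lt_trans _ Fi)// ltrDl.
- exact: compact_normed_closed.
apply: ball_density_disjoint; apply/disjoints_subset => x /(norm_lt_sqnorm r0) xz /PM xM.
have : `|z i| <= M + 1; last by rewrite leNgt Fi.
rewrite -(subKr x (z i)) (le_trans (ler_normB _ _))// lerD// ltW//.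
exact: lt_trans xz r1.
Unshelve. all: by end_near. Qed.

(** * Integer points *)

Section integer_points.
Context {d : nat}.

Definition cube_point (N : nat) (u : {ffun 'I_d -> 'I_(N.*2.+1)}) : 'rV[int]_d :=
  \row_i ((u i)%:Z - N%:Z).

Lemma cube_point_inj N : injective (@cube_point N).
Proof.
move=> u u' /rowP uu'; apply/ffunP => i; apply/val_inj.
by have := uu' i; rewrite !mxE => /addIr [].
Qed.

Lemma range_cube_point N : range (@cube_point N) = [set t | `|t| <= N%:Z].
Proof.
apply/seteqP; split=> [_ [u _ <-]|t tN].
  apply/ler_rV_norm => // i; rewrite mxE.
  by have := ltn_ord (u i); lia.
have tiN i : `|t 0 i| <= N%:Z by exact: le_trans (ler_norm_coord t i) tN.
exists [ffun i => inord `|(t 0 i + N%:Z)%R|%N] => //; apply/rowP => i.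
by rewrite !mxE ffunE inordK; have := tiN i; lia.
Qed.

Lemma finite_rV_int_norm_le (N : nat) : finite_set [set t : 'rV[int]_d | `|t| <= N%:Z].
Proof. by rewrite -range_cube_point; exact/finite_image/finite_finset. Qed.

Lemma norm_zvec_le {R : realType} (t : 'rV[int]_d) (N : nat) :
  `|zvec R t| <= N%:R -> `|t| <= N%:Z.
Proof.
move=> tN; apply/ler_rV_norm => // i; rewrite -(ler_int R) intr_norm.
by apply: (le_trans _ tN); have := ler_norm_coord (zvec R t) i; rewrite mxE.
Qed.

Lemma finite_zvec_norm_le {R : realType} (C : R) :
  finite_set [set t : 'rV[int]_d | `|zvec R t| <= C].
Proof.
apply: (sub_finite_set _ (finite_rV_int_norm_le (Num.trunc C).+1)) => t tC.
by apply: (@norm_zvec_le R); apply: (le_trans tC); rewrite ltW// truncnS_gt.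
Qed.

End integer_points.

(** * Multi-tilings *)

(* The elements of [G] written [w (x + t)] rather than [w x + t]: for each [w], the
   unit cube is then a fundamental domain of the translations [t]. *)
Definition wshift {R : realType} {d} (g : Gelt d) (x : vec R d) : vec R d :=
  wact g.1 (x + zvec R g.2).

Definition wshift_Gelt {d} (g : Gelt d) : Gelt d := (g.1, wact g.1 g.2).

Lemma wshift_Gelt_bij {d} : bijective (@wshift_Gelt d).
Proof.
exists (fun g => (g.1, wact (wact_inv g.1) g.2)) => -[w t].
  by rewrite /wshift_Gelt/= wactK.
by rewrite /wshift_Gelt/= wactVK.
Qed.

Section wshift.
Context {R : realType} {d : nat}.

Lemma Gact_wshift_Gelt (g : Gelt d) : @Gact R d (wshift_Gelt g) =1 wshift g.
Proof. by move=> x; rewrite /wshift wactD -zvec_wact. Qed.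

Lemma wshift_similarity (g : Gelt d) :
  @wshift R d g = similarity 1 g.1 (wact g.1 (zvec R g.2)).
Proof. by apply/funext => x; rewrite /similarity scale1r -wactD. Qed.

Lemma preimage_wshift w (t : 'rV[int]_d) (A : set (vec R d)) :
  wshift (w, t) @^-1` A =
  similarity 1 signed_perm1 (zvec R t) @^-1` (wact w @^-1` A).
Proof. by apply/funext => x; rewrite /preimage/= /similarity wact1 scale1r. Qed.

Lemma wact_similarity w : @wact d R w = similarity 1 w 0.
Proof. by apply/funext => x; rewrite /similarity scale1r addr0. Qed.

Lemma finite_wshift_norm_le (y : vec R d) (C : R) :
  finite_set [set g : Gelt d | `|wshift g y| <= C].
Proof.
pose T := [set t : 'rV[int]_d | `|zvec R t| <= C + `|y|].
apply: (@sub_finite_set _ _ ([set: signed_perm d] `*` T)) => [[w t] /= gC|].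
  suff : `|zvec R t| <= C + `|y| by [].
  rewrite -(addKr y (zvec R t)) (le_trans (ler_normD _ _))// normrN addrC.
  by rewrite lerD2r -(norm_wact w).
by apply: finite_setX; [exact: finite_finset|exact: finite_zvec_norm_le].
Qed.

End wshift.

Lemma measurable_null {R : realType} {d} (N : set (vec R d.+1)) :
  lebesgue_outer N = 0%E -> measurable (N : set (lebesgue_space R d)).
Proof.
move=> N0; apply: le_caratheodory_measurable => X /=.
have -> : lebesgue_outer (X `&` N) = 0%E.
  by apply/le_anti; rewrite lebesgue_outer_ge0 andbT -N0 le_lebesgue_outer.
by rewrite add0e; exact: le_lebesgue_outer.
Qed.

Lemma ae_lebesgue_rV {R : realType} {d} (Q : vec R d.+1 -> Prop) :
  ae Q -> {ae lebesgue_rV R d, forall x, Q x}.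
Proof.
move=> [N [N0 NQ]]; exists N; split=> //; first exact: measurable_null.
by move=> x; apply: contra_notP => /NQ.
Qed.

Lemma measurable_floor_rV_fiber {R : realType} {d} (t : 'rV[int]_d.+1) :
  measurable (floor_rV @^-1` [set t] : set (lebesgue_space R d)).
Proof.
have := measurable_grid_cell t (@ltr01 R); congr measurable.
by apply/funext => x; rewrite /grid_cell/= scale1r.
Qed.

Lemma esum_unit_cube_translates {R : realType} {d} (A : set (vec R d.+1)) :
  measurable (A : set (lebesgue_space R d)) ->
  (\esum_(t in [set: 'rV[int]_d.+1]) lebesgue_outer
    (unit_cube `&` similarity 1 signed_perm1 (zvec R t) @^-1` A) = lebesgue_outer A)%E.
Proof.
move=> mA; pose cell t : set (vec R d.+1) := floor_rV @^-1` [set t].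
have cellE t : similarity 1 signed_perm1 (zvec R t) @^-1` cell t = unit_cube.
  apply/seteqP; split=> x /=; rewrite /similarity wact1 scale1r => /rowP xt; apply/rowP => i.
    by have := xt i; rewrite !mxE floorDrz ?intr_int// intrKfloor -[X in _ = X]add0r => /addIr.
  by have := xt i; rewrite !mxE floorDrz ?intr_int// intrKfloor => ->; rewrite add0r.
under eq_esum => t _ do rewrite -(cellE t) -preimage_setI lebesgue_outer_isometry setIC.
have := @esum_measureI _ _ _ (lebesgue_rV R d) _ cell A 1 mA; rewrite mul1e; apply.
  by move=> t; exact: measurable_floor_rV_fiber.
by apply: aeW => x; exact: esum_indic_fiber.
Qed.

Definition multitiles_with {R : realType} {d} (P : set (vec R d)) (m : int) :=
  ae (fun x => \esum_(g in [set: Gelt d]) ((\1_P (Gact g x) : R)%:E) = (m%:~R)%:E).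

Section multitilings.
Context {R : realType} {d : nat} (P : set (vec R d.+1)) (m : int).
Hypothesis P_measurable : measurable (P : set (lebesgue_space R d)).
Hypothesis P_tiles : multitiles_with P m.

Lemma esum_tiling_measure (B : set (vec R d.+1)) :
  measurable (B : set (lebesgue_space R d)) ->
  (\esum_(g in [set: Gelt d.+1]) lebesgue_outer (B `&` wshift g @^-1` P) =
   (m%:~R)%:E * lebesgue_outer B)%E.
Proof.
move=> mB; apply: (@esum_measureI _ _ _ (lebesgue_rV R d) _ (fun g => wshift g @^-1` P)) => //.
  by move=> g; rewrite wshift_similarity; exact: measurable_similarity.
apply: ae_lebesgue_rV; have [N [N0 NP]] := P_tiles; exists N; split=> // x /NP <-.
rewrite (reindex_esum [set: Gelt d.+1] [set: Gelt d.+1] wshift_Gelt); last first.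
  by rewrite setTT_bijective; exact: wshift_Gelt_bij.
by apply: eq_esum => g _; rewrite Gact_wshift_Gelt.
Qed.

Lemma multiplicityE : m%:~R = #|{: signed_perm d.+1}|%:R * vol P.
Proof.
have := esum_tiling_measure (measurable_floor_rV_fiber 0).
rewrite lebesgue_outer_unit_cube mule1.
rewrite esum_pair_finType; last by move=> g; exact: lebesgue_outer_ge0.
under eq_bigr => w _.
  under eq_esum => t _ do rewrite preimage_wshift.
  rewrite esum_unit_cube_translates wact_similarity; last exact: measurable_similarity.
  rewrite lebesgue_outer_isometry; over.
rewrite sumr_const -[(_ *+ _)%R]mule_natl => /(congr1 fine).
by rewrite fine_EFinM => /= <-.
Qed.

End multitilings.

Section solid_angle_tiling.
Context {R : realType} {d : nat} (P : set (vec R d.+1)) (m : int).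
Hypothesis P_compact : compact (P : set 'rV[R]_d.+1).
Hypothesis P_angle : forall x, has_solid_angle P x.
Hypothesis P_tiles : multitiles_with P m.

Lemma finite_solid_angle_wshift (y : vec R d.+1) :
  finite_set [set g : Gelt d.+1 | solid_angle P (wshift g y) != 0].
Proof.
have [M PM] := compact_norm_le P_compact.
apply: (sub_finite_set _ (finite_wshift_norm_le y M)) => g /=; apply: contra_neqP => gM.
by apply: solid_angle_notin => [|/PM//]; exact: compact_normed_closed.
Qed.

Lemma ball_density_wshift (g : Gelt d.+1) (y : vec R d.+1) (r : R) :
  ball_density (wshift g @^-1` P) y r = ball_density P (wshift g y) r.
Proof. by rewrite wshift_similarity ball_density_similarity// mul1r. Qed.

Lemma sum_solid_angle_wshift (y : vec R d.+1) :
  \sum_(g \in [set: Gelt d.+1]) solid_angle P (wshift g y) = m%:~R.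
Proof.
near (0 : R)^'+ => r; have r0 : 0 < r by near: r; exact: nbhs_right_gt.
have densityE g : ball_density P (wshift g y) r = solid_angle P (wshift g y).
  move: g; near: r; apply: near_forall_ball_densityE => // C.
  exact: finite_wshift_norm_le.
have v0 := vol_eball_gt0 y r0.
have volE A : A `<=` eball y r -> lebesgue_outer A = (vol A)%:E.
  by move=> Ay; rewrite /vol fineK// (lebesgue_outer_eball_fin_num r0 Ay).
have densityM g : lebesgue_outer (eball y r `&` wshift g @^-1` P) =
    (solid_angle P (wshift g y) * vol (eball y r))%:E.
  by rewrite volE -?densityE -?ball_density_wshift ?divfK ?gt_eqF// => x [].
have := esum_tiling_measure (measurable_closed_rV (compact_normed_closed P_compact)) P_tiles
  (measurable_open_rV (@open_eball _ _ y r)).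
rewrite (eq_esum (fun g _ => densityM g)) esum_fsbig => [|g|]; last 2 first.
- by rewrite -lee_fin -densityM lebesgue_outer_ge0.
- apply: (sub_finite_set _ (finite_solid_angle_wshift y)) => g /=.
  by apply: contra_neq => ->; rewrite mul0r.
by rewrite volE// -EFinM -mulr_fsuml => -[] /(mulIf (lt0r_neq0 v0)).
Unshelve. all: by end_near. Qed.

End solid_angle_tiling.

(** * Gauss sums *)

Local Open Scope complex_scope.

Section expi.
Context {R : realType}.

Lemma expiD (a b : R) : expi (a + b) = expi a * expi b.
Proof. by rewrite /expi mulrDr cosD sinD/=; simpc; rewrite (addrC (sin _ * cos _)). Qed.

Lemma expi0 : expi (0 : R) = 1.
Proof. by rewrite /expi mulr0 cos0 sin0. Qed.

Lemma expi_nat (k : nat) : expi (k%:R : R) = 1.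
Proof.
elim: k => [|k IH]; first exact: expi0.
by rewrite -natr1 expiD IH mul1r /expi mulr1 [2 * pi]mulr_natl cos2pi sin2pi.
Qed.

Lemma expi_int (z : int) : expi (z%:~R : R) = 1.
Proof.
case: (intP z) => [|k|k]; [exact: expi0|exact: expi_nat|].
have := expi0; rewrite -(subrr (k.+1%:R)) expiD expi_nat mul1r.
by rewrite rmorphN.
Qed.

Lemma expi_sum (I : finType) (a : I -> R) : expi (\sum_i a i) = \prod_i expi (a i).
Proof. by apply: (big_morph _ expiD); exact: expi0. Qed.

End expi.

Lemma lattice_sumE {R : realType} {d} (F : 'rV[int]_d -> R[i]) :
  finite_set [set x | F x != 0] -> lattice_sum F = \sum_(x \in [set: 'rV[int]_d]) F x.
Proof.
move=> finF; have [N0 _ FN0] : \forall N \near \oo, forall x, F x != 0 -> `|x| <= N%:Z.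
  by apply: near_finite_set => // x _; exists (absz `|x|) => // N /=; lia.
have sumE N : (N0 <= N)%N -> cube_sum F N = \sum_(x \in [set: 'rV[int]_d]) F x.
  move=> /FN0 FN; rewrite -(fsbig_widen (range (@cube_point d N)))//.
    rewrite fsbig_image; last by move=> u u' _ _; exact: cube_point_inj.
    by rewrite fsbig_finType.
  move=> x [_]; rewrite range_cube_point => xN /=; apply/eqP.
  by apply: contrapT => /negP /FN.
apply: xget_subset1; first by exists N0.
move=> S S' [N1 sumS] [N2 sumS'].
by rewrite -(sumS (maxn N1 N2)) ?leq_maxl// sumS'// leq_maxr.
Qed.

Section residues.
Context {d : nat}.

Definition ord_rV {n} (k : {ffun 'I_d -> 'I_n}) : 'rV[int]_d := \row_i (k i)%:Z.

Definition residue_decomp n (p : {ffun 'I_d -> 'I_n} * 'rV[int]_d) : 'rV[int]_d :=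
  ord_rV p.1 + n%:Z *: p.2.

Lemma residue_decomp_bij n : (0 < n)%N -> bijective (@residue_decomp n).
Proof.
case: n => // n _; pose N : int := n.+1.
exists (fun x : 'rV[int]_d =>
  ([ffun i => inord `|((x 0 i)%R %% N)%Z|%N], \row_i ((x 0 i)%R %/ N)%Z)).
  move=> [k t]; have ltk i : 0 <= (k i)%:Z < N by rewrite lez_nat ltz_nat ltn_ord.
  congr pair; [apply/ffunP => i; apply: val_inj|apply/rowP => i].
    by rewrite ffunE !mxE /= addrC mulrC modzMDl modz_small ?ltk// absz_nat inord_val.
  by rewrite !mxE /= addrC mulrC divzMDl// divz_small ?addr0// ltk.
move=> x; apply/rowP => i; rewrite !mxE ffunE.
have r0 : (0 <= (x 0 i)%R %% N)%Z by exact: modz_ge0.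
have rN : ((x 0 i)%R %% N < N)%Z by exact: ltz_pmod.
rewrite inordK; last by move: r0 rN; rewrite /N; clear; lia.
by rewrite gez0_abs// addrC mulrC -divz_eq.
Qed.

End residues.

Definition gauss_weight {R : realType} {d} (n : nat) (x : 'rV[int]_d) : R[i] :=
  expi (sqnorm (zvec R x) / n%:R).

Section gauss_weight.
Context {R : realType} {d : nat}.

Lemma gauss_weight_wact n w (x : 'rV[int]_d) :
  gauss_weight n (wact w x) = gauss_weight n x :> R[i].
Proof. by rewrite /gauss_weight zvec_wact sqnorm_wact. Qed.

Lemma gauss_weight_residue n (p : {ffun 'I_d -> 'I_n} * 'rV[int]_d) : (0 < n)%N ->
  gauss_weight n (residue_decomp p) = gauss_weight n (ord_rV p.1) :> R[i].
Proof.
move=> n0; have nR_neq0 : n%:R != 0 :> R by rewrite pnatr_eq0 -lt0n.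
pose q i : int := p.2 0 i * (2 * (p.1 i)%:Z + n%:Z * p.2 0 i).
rewrite -[RHS]mulr1 -(expi_int (\sum_i q i)) -expiD; congr expi.
rewrite /sqnorm rmorph_sum/= !mulr_suml -big_split/=; apply: eq_bigr => i _.
rewrite !mxE /q !(rmorphM, rmorphD)/=; field; exact: nR_neq0.
Qed.

Lemma gauss_expn n :
  gauss R n ^+ d = \sum_(k : {ffun 'I_d -> 'I_n}) gauss_weight n (ord_rV k).
Proof.
rewrite -[in LHS](card_ord d) -prodr_const /gauss bigA_distr_bigA/=.
apply: eq_bigr => k _; rewrite -expi_sum; congr expi; rewrite /sqnorm mulr_suml.
by apply: eq_bigr => i _; rewrite !mxE natrX.
Qed.

End gauss_weight.

Section gauss_sum_of_tiling.
Context {R : realType} {d : nat} (P : set (vec R d.+1)) (m : int) (n : nat).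
Hypothesis n0 : (0 < n)%N.
Hypothesis P_compact : compact (P : set 'rV[R]_d.+1).
Hypothesis P_angle : forall x, has_solid_angle P x.
Hypothesis P_tiles : multitiles_with P m.

Let nR_gt0 : 0 < n%:R :> R.
Proof. by rewrite ltr0n. Qed.

Definition gauss_term (x : 'rV[int]_d.+1) : R[i] :=
  (solid_angle P (n%:R^-1 *: zvec R x))%:C * gauss_weight n x.

Lemma finite_gauss_term : finite_set [set x | gauss_term x != 0].
Proof.
have [M PM] := compact_norm_le P_compact.
apply: (sub_finite_set _ (finite_zvec_norm_le (n%:R * M))) => x /=.
apply: contra_neqP => xM; rewrite /gauss_term solid_angle_notin ?mul0r//.
  exact: compact_normed_closed.
by move=> /PM; rewrite normrZ gtr0_norm ?invr_gt0 ?nR_gt0// mulrC ler_pdivrMr// mulrC.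
Qed.

Lemma poly_gauss_fsbig : poly_gauss P n = \sum_(x \in [set: 'rV[int]_d.+1]) gauss_term x.
Proof.
rewrite -lattice_sumE; last exact: finite_gauss_term.
rewrite /poly_gauss; congr lattice_sum; apply/funext => x.
by rewrite (solid_angle_dilate _ _ nR_gt0) /gauss_term /gauss_weight.
Qed.

Lemma gauss_term_residue w (p : {ffun 'I_d.+1 -> 'I_n} * 'rV[int]_d.+1) :
  gauss_term (wact w (residue_decomp p)) =
  (solid_angle P (wshift (w, p.2) (n%:R^-1 *: zvec R (ord_rV p.1))))%:C *
  gauss_weight n (ord_rV p.1).
Proof.
have scaleE : n%:R^-1 *: zvec R (residue_decomp p) =
    n%:R^-1 *: zvec R (ord_rV p.1) + zvec R p.2.
  by apply/rowP => i; rewrite !mxE rmorphD rmorphM/=; field; rewrite gt_eqF ?nR_gt0.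
rewrite /gauss_term gauss_weight_wact (gauss_weight_residue _ n0).
by rewrite zvec_wact -wactZ scaleE.
Qed.

Lemma poly_gauss_residues w :
  poly_gauss P n = \sum_(k : {ffun 'I_d.+1 -> 'I_n})
    (\sum_(t \in [set: 'rV[int]_d.+1])
       solid_angle P (wshift (w, t) (n%:R^-1 *: zvec R (ord_rV k))))%:C *
    gauss_weight n (ord_rV k).
Proof.
have bij_wres : bijective (wact w \o @residue_decomp d.+1 n).
  by apply: bij_comp; [exact: wact_bij|exact: residue_decomp_bij].
rewrite poly_gauss_fsbig (reindex_fsbigT _ _ bij_wres) fsbig_pair_finType; last first.
  by apply: finite_preimage finite_gauss_term => p q _ _; exact: bij_inj.
apply: eq_bigr => k _; rewrite raddf_fsbig.
  by rewrite mulr_fsuml; apply: eq_fsbigr => t _; exact: gauss_term_residue.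
apply: finite_preimage (finite_solid_angle_wshift P_compact _) => t t' _ _.
by move=> [].
Qed.

Lemma poly_gauss_tiling : poly_gauss P n = (vol P)%:C * gauss R n ^+ d.+1.
Proof.
have W_neq0 : #|{: signed_perm d.+1}|%:R != 0 :> R[i].
  by rewrite pnatr_eq0 -lt0n; apply/card_gt0P; exists signed_perm1.
apply: (mulfI W_neq0); rewrite mulrA -(rmorph_nat (real_complex R)) -rmorphM.
rewrite -(multiplicityE (measurable_closed_rV (compact_normed_closed P_compact)) P_tiles).
rewrite rmorph_nat mulr_natl -[LHS]sumr_const.
rewrite (eq_bigr _ (fun w _ => poly_gauss_residues w)) exchange_big/= gauss_expn mulr_sumr.
apply: eq_bigr => k _; rewrite -mulr_suml; congr (_ * _); rewrite -rmorph_sum; congr (_%:C).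
rewrite -(sum_solid_angle_wshift P_compact P_angle P_tiles (n%:R^-1 *: zvec R (ord_rV k))).
rewrite fsbig_pair_finType//; exact: finite_solid_angle_wshift.
Qed.

End gauss_sum_of_tiling.

Theorem theorem1 (R : realType) (d : nat) (V : seq 'rV[int]_d) :
  (1 <= d)%N -> V <> [::] ->
  multitiles (lattice_hull (R:=R) V) ->
  forall n : nat, (0 < n)%N ->
    poly_gauss (lattice_hull (R:=R) V) n
    = ((vol (lattice_hull (R:=R) V))%:C * gauss R n ^+ d)%C.
Proof.
case: d V => // d V _ _ [m tileV] n n0.
apply: poly_gauss_tiling tileV => //; first exact: compact_lattice_hull.
by move=> x; apply: locally_conic_has_solid_angle; exact: lattice_hull_locally_conic.
Qed.
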